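(* Assume $m=n$. Then $\mathcal{D}_q=\operatorname{End}_{\mathcal{C}_q}V^{\otimes r}$ is isomorphic as a $K$-algebra to the $\mathbb{Z}_2$-crossed product $(\mathcal{B}_q)^{\psi_1}_{\alpha_1}[\mathbb{Z}_2]$, via $a_1u_1+a_2u_{-1}\mapsto a_1+a_2\varphi^{\otimes r}$ ($a_1,a_2\in\mathcal{B}_q$). In particular $\dim_K\mathcal{D}_q=2\dim_K\mathcal{B}_q$.
   Context: $q$ indeterminate, $K=\mathbb{Q}(q)$, $r\ge2$. $\mathcal{H}_{K,r}(q)$ is the type $A$ Iwahori–Hecke algebra (generators $T_1,\dots,T_{r-1}$, $T_i^2=(q-q^{-1})T_i+1$, braid relations); $T'_i=\frac{2T_i-(q-q^{-1})}{q+q^{-1}}$; the Goldman involution is the algebra automorphism with $\hat T_i=(q-q^{-1})-T_i$ and $\mathcal{H}^1_{K,r}(q)=\{X:\hat X=X\}$. $V$ is $\mathbb{Z}_2$-graded with basis $v_1,\dots,v_{2m}$, $|v_k|=0$ for $k\le m$, $1$ for $k>m$. The $q$-permutation representation $\pi_r$ of $\mathcal{H}_{K,r}(q)$ on $V^{\otimes r}$ is given by $\pi_r(T'_i)=\mathrm{Id}^{\otimes i-1}\otimes T'\otimes\mathrm{Id}^{\otimes r-i-1}$ with $T'(v_k\otimes v_k)=(-1)^{|v_k|}v_k\otimes v_k$ and for $k\ne l$, $T'(v_k\otimes v_l)=\frac{2(-1)^{|v_k||v_l|}}{q+q^{-1}}v_l\otimes v_k\pm\frac{q-q^{-1}}{q+q^{-1}}v_k\otimes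 v_l$ ($+$ if $k<l$, $-$ if $k>l$). $\mathcal{A}_q=\pi_r(\mathcal{H}_{K,r}(q))$, $\mathcal{C}_q=\pi_r(\mathcal{H}^1_{K,r}(q))$, $\mathcal{B}_q=\operatorname{End}_{\mathcal{A}_q}V^{\otimes r}$, $\mathcal{D}_q=\operatorname{End}_{\mathcal{C}_q}V^{\otimes r}$. $\varphi(v_i)=v_{2m-i+1}$, $\varphi^{\otimes r}(u_1\otimes\cdots\otimes u_r)=(-1)^{\sum_{i=2}^r\sum_{j<i}|u_j|}\varphi(u_1)\otimes\cdots\otimes\varphi(u_r)$; $\omega(f)=(-1)^{r(r-1)/2}\varphi^{\otimes r}f\varphi^{\otimes r}$ is an algebra automorphism of $\mathcal{B}_q$. $\psi_1(1)=\mathrm{id}$, $\psi_1(-1)=\omega$; $\alpha_1(\sigma,\tau)=1$ if $\sigma=1$ or $\tau=1$, $\alpha_1(-1,-1)=(-1)^{r(r-1)/2}$. For a crossed system $(A,G,\psi,\alpha)$ (${}^\sigma a:=\psi(\sigma)(a)$), the crossed product $A^\psi_\alpha[G]$ is the free left $A$-module with basis $\{u_\sigma\}_{\sigma\in G}$ and multiplication $(a_1u_\sigma)(a_2u_\tau)=a_1\,{}^\sigma a_2\,\alpha(\sigma,\tau)u_{\sigma\tau}$. *)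

(* Defs.v *)
From HB Require Import structures.
From mathcomp Require Import all_boot all_order all_algebra fingroup perm fraction.
Set Implicit Arguments. Unset Strict Implicit. Unset Printing Implicit Defensive.
Import Order.TTheory GRing.Theory Num.Theory.
Local Open Scope ring_scope.

Definition K := {fraction {poly rat}}.
Definition q : K := @FracField.tofrac _ ('X : {poly rat}).
Definition qd : K := q - q^-1.
Definition qs : K := q + q^-1.

(* Basis vector v_{k+1} (1-based in the paper) is index k : 'I_(m+m) here;
   its parity |v_{k+1}| is 1 iff m <= k. *)
Definition par (m : nat) (k : 'I_(m + m)) : bool := (m <= k)%N.
Definition sgn (b : bool) : K := (-1) ^+ b.

Definition Idx (m r : nat) : finType := {ffun 'I_r -> 'I_(m + m)}.
Definition dimT (m r : nat) : nat := #|{: Idx m r}|.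
(* Endomorphisms of V^{(x) r}, as matrices in the basis (enum (Idx m r));
   entry (w, u) = coefficient of basis vector w in the image of basis vector u. *)
Notation End m r := ('M[K]_(dimT m r)).

Definition mkEnd (m r : nat) (f : Idx m r -> Idx m r -> K) : End m r :=
  \matrix_(i, j) f (enum_val i) (enum_val j).

(* positions i and i+1 (0-based) for the generator T_{i+1}, i : 'I_r.-1 *)
Lemma pos2_proof (r : nat) (i : 'I_r.-1) : (i.+1 < r)%N.
Proof. by case: r i => [[]|r] //= i; rewrite ltnS. Qed.
Lemma pos1_proof (r : nat) (i : 'I_r.-1) : (i < r)%N.
Proof. exact: ltnW (pos2_proof i). Qed.
Definition pos1 (r : nat) (i : 'I_r.-1) : 'I_r := Ordinal (pos1_proof i).
Definition pos2 (r : nat) (i : 'I_r.-1) : 'I_r := Ordinal (pos2_proof i).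

Definition swapIdx (m r : nat) (i : 'I_r.-1) (u : Idx m r) : Idx m r :=
  [ffun p => u (tperm (pos1 i) (pos2 i) p)].

Definition piTp (m r : nat) (i : 'I_r.-1) : End m r :=
  mkEnd (fun w u =>
    let k := u (pos1 i) in let l := u (pos2 i) in
    if k == l then (w == u)%:R * sgn (par k)
    else (w == swapIdx i u)%:R * (2 * sgn (par k && par l) / qs)
       + (w == u)%:R * ((if (k < l)%N then 1 else -1) * qd / qs)).

(* pi_r(T_{i+1}),  since T_i = ((q+q^{-1}) T'_i + (q-q^{-1})) / 2 *)
Definition piT (m r : nat) (i : 'I_r.-1) : End m r :=
  (2 : K)^-1 *: (qs *: @piTp m r i + qd%:M).

(* ---------- The Hecke algebra H_{K,r}(q), via its (faithful) left
   regular representation on K^{S_r} with basis T_w ---------- *)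
Definition ninv (r : nat) (w : 'S_r) : nat :=
  #|[set p : 'I_r * 'I_r | (p.1 < p.2)%N && (w p.2 < w p.1)%N]|.
Definition sgen (r : nat) (i : 'I_r.-1) : 'S_r := tperm (pos1 i) (pos2 i).
Notation HReg r := ('M[K]_(#|{: 'S_r}|)).
(* left multiplication by T_{i+1}:  T_s T_w = T_{sw} if l(sw) > l(w),
   and T_{sw} + (q-q^{-1}) T_w otherwise *)
Definition regT (r : nat) (i : 'I_r.-1) : HReg r :=
  \matrix_(a, b)
    let v : 'S_r := enum_val a in let w : 'S_r := enum_val b in
    (v == (sgen i * w)%g)%:R
    + (v == w)%:R * ((ninv (sgen i * w)%g < ninv w)%N)%:R * qd.
(* image of T_{i+1} under the Goldman involution *)
Definition regThat (r : nat) (i : 'I_r.-1) : HReg r := qd%:M - regT i.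

(* Noncommutative polynomials in the generators T_1..T_{r-1}
   (elements of the free algebra), and their evaluation. *)
Definition fword (r : nat) := seq (K * seq 'I_r.-1).
Definition fev (n r : nat) (G : 'I_r.-1 -> 'M[K]_n) (x : fword r) : 'M[K]_n :=
  \sum_(p <- x) p.1 *: \prod_(j <- p.2) G j.

Definition Aq (m r : nat) (f : End m r) : Prop :=
  exists x : fword r, f = fev (@piT m r) x.
(* C_q = pi_r(H^1),  H^1 = {X in H | hat X = X} *)
Definition Cq (m r : nat) (f : End m r) : Prop :=
  exists x : fword r, fev (@regT r) x = fev (@regThat r) x /\ f = fev (@piT m r) x.
Definition Bq (m r : nat) (f : End m r) : Prop :=
  forall a, Aq a -> f *m a = a *m f.
Definition Dq (m r : nat) (f : End m r) : Prop :=
  forall c, Cq c -> f *m c = c *m f.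

Definition phiT (m r : nat) : End m r :=
  mkEnd (fun w u =>
    (w == [ffun p => rev_ord (u p)])%:R *
    sgn (odd (\sum_(i < r) \sum_(j < r | (j < i)%N) par (u j)))).
Definition rsign (r : nat) : K := (-1) ^+ (r * r.-1)./2.
Definition omega (m r : nat) (f : End m r) : End m r :=
  rsign r *: (phiT m r *m f *m phiT m r).

(* Z_2 = {1,-1} is encoded as bool: false = 1, true = -1; product = addb. *)
Definition psi1 (m r : nat) (s : bool) (f : End m r) : End m r :=
  if s then omega f else f.
Definition alpha1 (r : nat) (s t : bool) : K :=
  if s && t then rsign r else 1.

(* The crossed product (B_q)^{psi_1}_{alpha_1}[Z_2]: an element
   sum_s x(s) u_s is represented by its coefficient function x : bool -> End;
   it lies in the crossed product iff all x(s) are in B_q. *)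
Definition inCP (m r : nat) (x : bool -> End m r) : Prop :=
  forall s, Bq (x s).
Definition cp_mul (m r : nat) (x y : bool -> End m r) : bool -> End m r :=
  fun rho => \sum_(s : bool) \sum_(t : bool | addb s t == rho)
               alpha1 r s t *: (x s *m psi1 s (y t)).
Definition cp_one (m r : nat) : bool -> End m r :=
  fun s => if s then 0 else 1%:M.
Definition Theta (m r : nat) (x : bool -> End m r) : End m r :=
  x false + x true *m phiT m r.

Definition has_dim (m r : nat) (S : End m r -> Prop) (d : nat) : Prop :=
  exists b : d.-tuple (End m r), free b /\ forall f, S f <-> f \in <<b>>%VS.

(* Main.v *)
Require Import Defs.
From mathcomp Require Import all_boot all_order all_algebra fingroup perm fraction.
From mathcomp Require Import zify ring.
From Stdlib Require Import FunctionalExtensionality.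
Set Implicit Arguments. Unset Strict Implicit. Unset Printing Implicit Defensive.
Import Order.TTheory GRing.Theory.
Local Open Scope ring_scope.

(* The operator [phi] of [V^{(x) r}] satisfies [phi T_i = hat T_i phi] and
   [phi^2 = rsign r], so it commutes with [C_q] and implements [omega] on [B_q].
   That [pi_r] carries the Goldman involution to conjugation by [phi] requires
   [pi_r] to factor through the regular representation: for every vector [v] of
   a Hecke module, a map [T_w |-> T_w v] is built by induction on the length of
   [w], where braid relations give independence of the chosen left descent.

   Let [tau = T_1 - (q - q^-1)/2].  It is odd for the Goldman involution, and
   [tau^2] is a nonzero scalar [c], hence [A_q = C_q + C_q tau].  Conjugation by
   [tau] preserves [D_q], so any [d] in [D_q] is the sum of
   [(d + c^-1 tau d tau)/2] and [(d - c^-1 tau d tau)/2]; the first commutes with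
   [tau], hence lies in [B_q], the second anticommutes with [tau], hence lies in
   [B_q phi].  The sum is direct because [phi] anticommutes with [tau]. *)

(** * Scalars in [K] *)

Lemma q_neq0 : q != 0.
Proof. by rewrite /q tofrac_eq0 polyX_eq0. Qed.

Lemma two_neq0 : (2 : K) != 0.
Proof.
have -> : (2 : K) = FracField.tofrac (2 : {poly rat}) by rewrite rmorph_nat.
rewrite tofrac_eq0; apply/eqP => /(congr1 (fun p : {poly rat} => p.[0])).
by rewrite -polyC_natr hornerC horner0.
Qed.

Lemma qs_neq0 : qs != 0.
Proof.
have qE : qs * q = FracField.tofrac ('X ^+ 2 + 1 : {poly rat}).
  by rewrite /qs mulrDl mulVf ?q_neq0 // rmorphD rmorphXn rmorph1 expr2.
apply/eqP => qs0; move/eqP: qE; rewrite qs0 mul0r eq_sym tofrac_eq0.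
by rewrite -size_poly_eq0 size_XnaddC.
Qed.

Lemma qs_sqr : qs ^+ 2 = qd ^+ 2 + 4.
Proof.
rewrite /qs /qd; move: q q_neq0 => x x0.
have: x * x^-1 = 1 by rewrite mulfV.
move: x^-1 => y xy; rewrite sqrrD sqrrB xy; ring.
Qed.

(** * Length and left descents in the symmetric group *)

Lemma ninv1 r : ninv (1%g : 'S_r) = 0%N.
Proof.
apply/eqP; rewrite cards_eq0; apply/eqP/setP => -[a b]; rewrite !inE /= !perm1.
by case: ltngtP.
Qed.

(** Products of permutations apply the left factor first, so left multiplication by [sgen i]
    exchanges the values of [w] at two adjacent positions: this is a left descent. *)
Definition descent r (w : 'S_r) (i : 'I_r.-1) := (w (pos2 i) < w (pos1 i))%N.

Lemma sgenE r (i : 'I_r.-1) (p : 'I_r) :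
  nat_of_ord (sgen i p) =
    if (p == i :> nat) then i.+1 else if (p == i.+1 :> nat) then nat_of_ord i else p.
Proof.
rewrite /sgen; case: tpermP => [->|->|/eqP + /eqP] /=; rewrite ?eqxx //.
  by rewrite gtn_eqF.
by rewrite -!val_eqE /= => /negPf-> /negPf->.
Qed.

Lemma sgen_fix r (i : 'I_r.-1) (p : 'I_r) :
  (p < i)%N || (i.+1 < p)%N -> sgen i p = p.
Proof. by move=> h; apply: tpermD; rewrite -val_eqE /=; lia. Qed.

Lemma sgen_pos1 r (i : 'I_r.-1) : sgen i (pos1 i) = pos2 i.
Proof. exact: tpermL. Qed.

Lemma sgen_pos2 r (i : 'I_r.-1) : sgen i (pos2 i) = pos1 i.
Proof. exact: tpermR. Qed.

Lemma sgen_sgen r (i : 'I_r.-1) : (sgen i * sgen i)%g = 1%g.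
Proof. by rewrite /sgen tperm2. Qed.

Lemma sgen_mulK r (i : 'I_r.-1) (w : 'S_r) : (sgen i * (sgen i * w))%g = w.
Proof. by rewrite mulgA sgen_sgen mul1g. Qed.

Lemma sgen_comm r (i j : 'I_r.-1) : (i.+1 < j)%N ->
  (sgen i * sgen j)%g = (sgen j * sgen i)%g.
Proof.
move=> ij; apply/permP => p; apply/val_inj; rewrite !permM /= !sgenE.
by do ?[case: eqP => /=]; lia.
Qed.

Lemma sgen_braid r (i j : 'I_r.-1) : j = i.+1 :> nat ->
  (sgen i * (sgen j * sgen i))%g = (sgen j * (sgen i * sgen j))%g.
Proof.
move=> ij; apply/permP => p; apply/val_inj; rewrite !permM /= !sgenE.
by do ?[case: eqP => /=]; lia.
Qed.

Lemma descent_sgen r (i : 'I_r.-1) (w : 'S_r) :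
  descent (sgen i * w)%g i = ~~ descent w i.
Proof.
rewrite /descent !permM sgen_pos1 sgen_pos2 -leqNgt [RHS]leq_eqVlt.
by rewrite (inj_eq val_inj) (inj_eq perm_inj) -val_eqE /= ltn_eqF.
Qed.

(** Applying [sgen i] to both positions injects the inversions of [sgen i * w] into those of [w],
    and misses the inversion [(pos1 i, pos2 i)]. *)
Lemma ninv_descent r (i : 'I_r.-1) (w : 'S_r) :
  descent w i -> (ninv (sgen i * w)%g < ninv w)%N.
Proof.
move=> dw; rewrite /ninv.
set B := [set p | _ & (w p.2 < _)%N].
have inB : (pos1 i, pos2 i) \in B by rewrite inE /= ltnSn.
rewrite [#|B|](cardsD1 (pos1 i, pos2 i)) inB add1n ltnS.
pose f (p : 'I_r * 'I_r) := (sgen i p.1, sgen i p.2).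
rewrite -(card_imset _ (_ : injective f)); last first.
  by move=> [a b] [c d] [] /perm_inj-> /perm_inj->.
apply/subset_leq_card/subsetP => _ /imsetP[[a b] + ->].
rewrite !inE /f /= !permM => /andP[ab wab]; rewrite wab andbT.
have nab : ~~ ((a == i :> nat) && (b == i.+1 :> nat)).
  apply: contraL wab => /andP[ai bi].
  have -> : a = pos1 i by apply/val_inj/eqP.
  have -> : b = pos2 i by apply/val_inj/eqP.
  by rewrite sgen_pos1 sgen_pos2 -leqNgt ltnW.
rewrite xpair_eqE -!val_eqE /= !sgenE; apply/andP; split; do ?[case: eqP => /=]; lia.
Qed.

Lemma descent_ninv r (i : 'I_r.-1) (w : 'S_r) :
  (ninv (sgen i * w)%g < ninv w)%N = descent w i.
Proof.
apply/idP/idP => [|/ninv_descent //]; apply: contraLR.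
rewrite -descent_sgen => /ninv_descent; rewrite sgen_mulK => lt.
by rewrite -leqNgt ltnW.
Qed.

(** * Hecke modules and the regular representation *)

Record hecke_family r n (G : 'I_r.-1 -> 'M[K]_n) : Prop := HeckeFamily {
  hecke_quad i : G i *m G i = qd *: G i + 1%:M;
  hecke_comm (i j : 'I_r.-1) : (i.+1 < j)%N -> G i *m G j = G j *m G i;
  hecke_braid (i j : 'I_r.-1) : j = i.+1 :> nat ->
    G i *m (G j *m G i) = G j *m (G i *m G j) }.

Section RegularRepresentation.
Variables (r n : nat) (G : 'I_r.-1 -> 'M[K]_n) (hG : hecke_family G).
Implicit Types (w : 'S_r) (F : 'S_r -> 'cV[K]_n) (i j : 'I_r.-1).

(** [F w] stands for [T_w v]. The bound [k] on the length allows a construction by induction. *)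
Definition descends F k := forall w i,
  (ninv w <= k)%N -> descent w i -> F w = G i *m F (sgen i * w)%g.

(** Both sides are expanded further until they end at the same shorter permutation; the braid or the
    commutation relation then compares the coefficients. *)
Lemma descends_confluent_lt F k w i j : descends F k -> (ninv w <= k.+1)%N ->
    (i < j)%N -> descent w i -> descent w j ->
  G i *m F (sgen i * w)%g = G j *m F (sgen j * w)%g.
Proof.
move=> dF wk ij di dj.
have ki := leq_trans (ninv_descent di) wk.
have kj := leq_trans (ninv_descent dj) wk.
have [eij|ltij] := eqVneq (j : nat) i.+1.
  (* Here [w] decreases along three consecutive positions, so three generators can be stripped from
     it, starting with either descent. *)
  have e21 : pos2 i = pos1 j by apply: val_inj.
  have i2 : sgen i (pos2 j) = pos2 j by apply: sgen_fix => /=; lia.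
  have j1 : sgen j (pos1 i) = pos1 i by apply: sgen_fix => /=; lia.
  have di1 : descent (sgen i * w)%g j.
    rewrite /descent !permM i2 -e21 sgen_pos2.
    by move: di dj; rewrite /descent e21 => h1 h2; apply: ltn_trans h2 h1.
  have dj1 : descent (sgen j * w)%g i.
    rewrite /descent !permM j1 e21 sgen_pos1.
    by move: di dj; rewrite /descent e21 => h1 h2; apply: ltn_trans h2 h1.
  have di2 : descent (sgen j * (sgen i * w))%g i.
    by rewrite /descent !permM j1 e21 !sgen_pos1 i2 e21.
  have dj2 : descent (sgen i * (sgen j * w))%g j.
    by rewrite /descent !permM i2 -e21 !sgen_pos2 j1 -e21.
  have ki2 := leq_trans (ltnW (ninv_descent di1)) ki.
  have kj2 := leq_trans (ltnW (ninv_descent dj1)) kj.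
  rewrite (dF _ _ ki di1) (dF _ _ kj dj1) (dF _ _ ki2 di2) (dF _ _ kj2 dj2).
  rewrite !mulmxA -!(mulmxA (G _) (G _) (G _)) (hecke_braid hG eij).
  by rewrite !mulgA -!(mulgA (sgen _) (sgen _) (sgen _)) (sgen_braid eij).
have {}ltij : (i.+1 < j)%N by lia.
have fixp (p : 'I_r) : (p == j :> nat) || (p == j.+1 :> nat) -> sgen i p = p.
  by move=> h; apply: sgen_fix; lia.
have fixp' (p : 'I_r) : (p == i :> nat) || (p == i.+1 :> nat) -> sgen j p = p.
  by move=> h; apply: sgen_fix; lia.
have di1 : descent (sgen i * w)%g j.
  by rewrite /descent !permM !fixp //= eqxx ?orbT.
have dj1 : descent (sgen j * w)%g i.
  by rewrite /descent !permM !fixp' //= eqxx ?orbT.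
rewrite (dF _ _ ki di1) (dF _ _ kj dj1) !mulmxA (hecke_comm hG ltij).
by rewrite !mulgA (sgen_comm ltij).
Qed.

Lemma descends_confluent F k w i j : descends F k -> (ninv w <= k.+1)%N ->
    descent w i -> descent w j ->
  G i *m F (sgen i * w)%g = G j *m F (sgen j * w)%g.
Proof.
move=> dF wk di dj; case: (ltngtP i j) => [ij|ji|/val_inj-> //].
  exact: descends_confluent_lt dF wk ij di dj.
exact/esym/(descends_confluent_lt dF wk ji dj di).
Qed.

Lemma descends_exists (v : 'cV[K]_n) k : exists2 F, F 1%g = v & descends F k.
Proof.
elim: k => [|k [F F1 dF]].
  exists (fun=> v) => // w i; rewrite leqn0 => /eqP w0 /ninv_descent.
  by rewrite w0.
(* Any descent may be picked, by confluence. The default [0] concerns only permutations without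
   descent, on which [descends] imposes nothing. *)
exists (fun w => if (ninv w <= k)%N then F w else
  if [pick i | descent w i] is Some i then G i *m F (sgen i * w)%g else 0).
  by rewrite ninv1.
move=> w i wk di; have -> : (ninv (sgen i * w)%g <= k)%N.
  by rewrite -ltnS (leq_trans (ninv_descent di)).
case: leqP => [wk'|_]; first exact: dF.
case: pickP => [j dj|/(_ i)]; last by rewrite di.
exact: descends_confluent dF wk dj di.
Qed.

(** The column of [Q] at [w] is [T_w v]. If [i] is a descent of [w], the quadratic relation gives
    the action of [G i] on it; otherwise [i] is a descent of [sgen i * w]. *)
Lemma regT_intertwiner (v : 'cV[K]_n) :
  exists Q : 'M[K]_(n, #|{: 'S_r}|),
    col (enum_rank (1%g : 'S_r)) Q = v /\ forall i, Q *m regT i = G i *m Q.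
Proof.
have [F F1 dF] := descends_exists v (\max_(w : 'S_r) ninv w).
have {}dF w i : descent w i -> F w = G i *m F (sgen i * w)%g.
  by apply: dF; apply: (leq_bigmax w).
pose Q : 'M[K]_(n, #|{: 'S_r}|) := \matrix_(a, b) F (enum_val b) a 0.
have colQ b : col b Q = F (enum_val b).
  by apply/colP => a; rewrite !mxE.
exists Q; split=> [|i]; first by rewrite colQ enum_rankK.
apply/matrixP => a b; set w := enum_val b.
have -> : (Q *m regT i) a b =
    (F (sgen i * w)%g + ((descent w i)%:R * qd) *: F w) a 0.
  rewrite !mxE (eq_bigr (fun c => F (enum_val c) a 0 * (enum_val c == (sgen i * w)%g)%:R +
     F (enum_val c) a 0 * (enum_val c == w)%:R * ((descent w i)%:R * qd))); last first.
    by move=> c _; rewrite !mxE /= -/w descent_ninv mulrDr !mulrA.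
  rewrite big_split /= -mulr_suml.
  have delta x : \sum_(c < #|{: 'S_r}|) F (enum_val c) a 0 * (enum_val c == x)%:R = F x a 0.
    rewrite (bigD1 (enum_rank x)) //= enum_rankK eqxx mulr1 big1 ?addr0 // => c.
    by rewrite -(inj_eq enum_val_inj) enum_rankK => /negPf->; rewrite mulr0.
  by rewrite !delta mulrC.
have -> : (G i *m Q) a b = (G i *m F w) a 0.
  by rewrite !mxE; apply: eq_bigr => c _; rewrite !mxE.
congr (fun_of_matrix _ a 0); have [dw|ndw] := boolP (descent w i).
  rewrite [in RHS](dF _ _ dw) mulmxA (hecke_quad hG) mulmxDl mul1mx -scalemxAl.
  by rewrite -(dF _ _ dw) mul1r addrC.
rewrite mul0r scale0r addr0; rewrite -descent_sgen in ndw.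
by rewrite (dF _ _ ndw) sgen_mulK.
Qed.

End RegularRepresentation.

(** * Evaluation of noncommutative polynomials *)

Lemma fev_intertwine r n p (G : 'I_r.-1 -> 'M[K]_n) (G' : 'I_r.-1 -> 'M[K]_p)
    (Q : 'M[K]_(n, p)) (x : fword r) :
  (forall i, Q *m G' i = G i *m Q) -> Q *m fev G' x = fev G x *m Q.
Proof.
move=> QG; rewrite /fev mulmx_sumr mulmx_suml; apply: eq_bigr => -[c s] _ /=.
rewrite -scalemxAr -scalemxAl; congr (_ *: _); elim: s => [|i s IH].
  by rewrite !big_nil mulmx1 mul1mx.
by rewrite !big_cons -![GRing.mul _ _]/(_ *m _) mulmxA QG -!mulmxA IH.
Qed.

(* [P] is the evaluation of a noncommutative polynomial, uniformly in the
   matrices substituted for its variables. *)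
Definition polynomial r (P : forall n, ('I_r.-1 -> 'M[K]_n) -> 'M[K]_n) :=
  exists x : fword r, forall n (G : 'I_r.-1 -> 'M[K]_n), fev G x = P n G.

Section Polynomial.
Variable r : nat.
Implicit Types P Q : forall n, ('I_r.-1 -> 'M[K]_n) -> 'M[K]_n.

Lemma polynomial_fev (x : fword r) : polynomial (fun n G => fev G x).
Proof. by exists x. Qed.

Lemma polynomial_const (c : K) : @polynomial r (fun n G => c%:M).
Proof.
by exists [:: (c, [::])] => n G; rewrite /fev big_seq1 /= big_nil scalemx1.
Qed.

Lemma polynomial_gen (i : 'I_r.-1) : polynomial (fun n G => G i).
Proof.
by exists [:: (1, [:: i])] => n G; rewrite /fev big_seq1 /= big_seq1 scale1r.
Qed.

Lemma polynomialD P Q : polynomial P -> polynomial Q ->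
  polynomial (fun n G => P n G + Q n G).
Proof.
move=> [x xP] [y yQ]; exists (x ++ y) => n G.
by rewrite -xP -yQ /fev big_cat.
Qed.

Lemma polynomialM P Q : polynomial P -> polynomial Q ->
  polynomial (fun n G => P n G *m Q n G).
Proof.
move=> [x xP] [y yQ].
exists [seq (a.1 * b.1, a.2 ++ b.2) | a <- x, b <- y] => n G.
rewrite -xP -yQ /fev big_allpairs_dep /= mulmx_suml; apply: eq_bigr => a _.
rewrite mulmx_sumr; apply: eq_bigr => b _.
by rewrite big_cat /= -scalemxAl -scalemxAr scalerA.
Qed.

Lemma polynomialZ (c : K) P : polynomial P -> polynomial (fun n G => c *: P n G).
Proof.
move=> pP; have [z zP] := polynomialM (polynomial_const c) pP.
by exists z => n G; rewrite zP mul_scalar_mx.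
Qed.

Lemma polynomialB P Q : polynomial P -> polynomial Q ->
  polynomial (fun n G => P n G - Q n G).
Proof.
move=> pP pQ; have [z zP] := polynomialD pP (polynomialZ (-1) pQ).
by exists z => n G; rewrite zP scaleN1r.
Qed.

(** Lifts the Goldman involution to the free algebra, by expanding each substituted word. *)
Lemma polynomial_goldman (x : fword r) :
  polynomial (fun n G => fev (fun i => qd%:M - G i) x).
Proof.
elim: x => [|[c s] x IH].
  by exists [::] => n G; rewrite /fev !big_nil.
suff [y yE] : polynomial (fun n (G : 'I_r.-1 -> 'M[K]_n) => \prod_(j <- s) (qd%:M - G j)).
  have [z zE] := polynomialD (polynomialZ c (ex_intro _ y yE)) IH.
  by exists z => n G; rewrite zE /fev big_cons.
elim: s => [|i s [y yE]].
  have [y yE] := polynomial_const 1.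
  by exists y => n G; rewrite yE big_nil.
have [z zE] := polynomialM
  (polynomialB (polynomial_const qd) (polynomial_gen i)) (ex_intro _ y yE).
by exists z => n G; rewrite zE big_cons.
Qed.

End Polynomial.

(* The regular representation is faithful: every Hecke module is a quotient of
   copies of it. *)
Lemma fev_regT_eq r n (G : 'I_r.-1 -> 'M[K]_n) (x y : fword r) :
  hecke_family G -> fev (@regT r) x = fev (@regT r) y -> fev G x = fev G y.
Proof.
move=> hG xy; apply/trmx_inj/row_matrixP => j.
rewrite -!tr_col; congr trmx.
have [Q [Q1 QG]] := regT_intertwiner hG (delta_mx j 0).
rewrite !colE -Q1 colE !mulmxA -!(fev_intertwine x QG) -!(fev_intertwine y QG).
by rewrite xy.
Qed.

(** * The Goldman involution and the quadratic relation *)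

Definition goldman n r (G : 'I_r.-1 -> 'M[K]_n) (i : 'I_r.-1) : 'M[K]_n :=
  qd%:M - G i.

Lemma goldmanK n r (G : 'I_r.-1 -> 'M[K]_n) x : fev (goldman (goldman G)) x = fev G x.
Proof.
rewrite /fev; apply: eq_bigr => -[c s] _ /=; congr (_ *: _).
by apply: eq_bigr => i _; rewrite /goldman subKr.
Qed.

Lemma four_neq0 (F : fieldType) : (2 : F) != 0 -> (4 : F) != 0.
Proof. by move=> n2; rewrite (_ : 4 = 2 * 2) ?mulf_neq0 //; ring. Qed.

Lemma add_halves (F : fieldType) (d : F) : (2 : F) != 0 -> d / 2 + d / 2 = d.
Proof. by move=> n2; field. Qed.

(** Completing the square; for [d = qd] the scalar is [qs ^+ 2 / 4]. *)
Lemma shifted_sqr (F : fieldType) p (d : F) (M : 'M[F]_p) : (2 : F) != 0 ->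
  M *m M = d *: M + 1%:M ->
  (M - (d / 2)%:M) *m (M - (d / 2)%:M) = ((d ^+ 2 + 4) / 4)%:M.
Proof.
move=> n2 M2; rewrite mulmxBl !mulmxBr M2 mul_mx_scalar !mul_scalar_mx.
apply/matrixP => i j; rewrite !mxE; case: (i == j); rewrite ?mulr1n ?mulr0n.
  by field; rewrite n2 four_neq0.
by field; rewrite n2.
Qed.

(** * The double centralizer argument *)

Section DoubleCentralizer.
(* [G] is a representation of the Hecke algebra and [phi] implements the
   Goldman involution on it. *)
Variables (r n : nat) (G : 'I_r.-1 -> 'M[K]_n) (hG : hecke_family G).
Variables (phi : 'M[K]_n) (e : K).
Hypothesis phiG : forall i, phi *m G i = goldman G i *m phi.
Hypothesis phi2 : phi *m phi = e%:M.
Hypothesis e2 : e * e = 1.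
Variable i0 : 'I_r.-1.

(** For [G := @piT m r] these four predicates unfold to [Aq], [Cq], [Bq] and [Dq]. *)
Definition imA (f : 'M[K]_n) := exists x : fword r, f = fev G x.
Definition imC (f : 'M[K]_n) :=
  exists x : fword r, fev (@regT r) x = fev (@regThat r) x /\ f = fev G x.
Definition commB (f : 'M[K]_n) := forall a, imA a -> f *m a = a *m f.
Definition commD (f : 'M[K]_n) := forall c, imC c -> f *m c = c *m f.

Let c0 : K := qs ^+ 2 / 4.
(** Locked to stay opaque; it is expanded only through [tauE]. *)
Let tau : 'M[K]_n := locked (G i0 - (qd / 2)%:M).

Lemma tauE : tau = G i0 - (qd / 2)%:M.
Proof. by rewrite /tau -lock. Qed.

Lemma c0_neq0 : c0 != 0.
Proof.
apply: mulf_neq0; first exact: expf_neq0 qs_neq0.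
by rewrite invr_eq0; apply: four_neq0 two_neq0.
Qed.

Lemma tau2 : tau *m tau = c0%:M.
Proof. by rewrite tauE /c0 qs_sqr; apply: shifted_sqr two_neq0 (hecke_quad hG i0). Qed.

Lemma phi_tau : phi *m tau = - (tau *m phi).
Proof.
rewrite tauE mulmxBr phiG /goldman !mulmxBl opprB mul_mx_scalar !mul_scalar_mx.
by rewrite -[X in X *: _ - _ - _](add_halves qd two_neq0) scalerDl addrAC addrK.
Qed.

Lemma imA_poly P : @polynomial r P -> imA (P n G).
Proof. by case=> x xP; exists x. Qed.

(** Invariance is tested in the regular representation while the element is evaluated at [G], whence
    the uniformity asked of [P]. *)
Lemma imC_poly P : @polynomial r P -> P _ (@regT r) = P _ (goldman (@regT r)) ->
  imC (P n G).
Proof. by case=> x xP PR; exists x; rewrite !xP. Qed.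

Lemma goldman_tau p (M : 'I_r.-1 -> 'M[K]_p) :
  goldman M i0 - (qd / 2)%:M = - (M i0 - (qd / 2)%:M).
Proof.
rewrite opprB /goldman -[X in X%:M - _ - _](add_halves qd two_neq0).
by rewrite [X in X - _ - _]raddfD /= addrAC addrK.
Qed.

Lemma polynomial_tau : @polynomial r (fun p M => M i0 - (qd / 2)%:M).
Proof. exact: polynomialB (polynomial_gen _) (polynomial_const _ _). Qed.

(** The Goldman involution negates both factors [tau], and the signs cancel. *)
Lemma imC_conj_tau c : imC c -> imC (tau *m c *m tau).
Proof.
move=> [x [xR ->]]; rewrite tauE.
apply: (imC_poly (P := fun p M => (M i0 - (qd / 2)%:M) *m fev M x *m (M i0 - (qd / 2)%:M))).
  exact: polynomialM (polynomialM polynomial_tau (polynomial_fev x)) polynomial_tau.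
by rewrite goldman_tau xR mulNmx mulmxN mulNmx opprK.
Qed.

Lemma imA_split a : imA a ->
  exists c c', [/\ imC c, imC c' & a = c + c' *m tau].
Proof.
move=> [x ->]; have [y yE] := polynomial_goldman x.
have yE' p (M : 'I_r.-1 -> 'M[K]_p) : fev M y = fev (goldman M) x by exact: yE.
have px := polynomial_fev x; have py := polynomial_fev y.
(* With [y] the Goldman image of [x], these are the even half, and the odd half times [tau / c0];
   the latter is even as a product of two odd elements, and [tau ^ 2 = c0] restores the odd half. *)
exists (2^-1 *: (fev G x + fev G y)).
exists ((2 * c0)^-1 *: ((fev G x - fev G y) *m tau)); split.
- apply: (imC_poly (P := fun p M => 2^-1 *: (fev M x + fev M y))).
    exact: polynomialZ (polynomialD px py).
  by rewrite !yE' goldmanK addrC.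
- rewrite tauE; apply: (imC_poly (P := fun p M =>
    (2 * c0)^-1 *: ((fev M x - fev M y) *m (M i0 - (qd / 2)%:M)))).
    exact: polynomialZ (polynomialM (polynomialB px py) polynomial_tau).
  by rewrite !yE' goldmanK goldman_tau mulmxN -mulNmx opprB.
rewrite -scalemxAl -mulmxA tau2 mul_mx_scalar scalerA invfM -mulrA (mulVf c0_neq0).
rewrite mulr1 -scalerDr addrACA subrr addr0 -mulr2n -scaler_nat scalerA.
by rewrite (mulVf two_neq0) scale1r.
Qed.

Lemma commB_tau f : commB f -> f *m tau = tau *m f.
Proof. by move=> fB; apply: fB; rewrite tauE; apply: imA_poly polynomial_tau. Qed.

(** By [imA_split], the algebra is generated by the invariants together with [tau]. *)
Lemma commBP f : commD f -> f *m tau = tau *m f -> commB f.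
Proof.
move=> fC ft a /imA_split[c [c' [hc hc' ->]]].
by rewrite mulmxDr mulmxDl fC // mulmxA fC // -!mulmxA ft.
Qed.

Lemma commB_commD f : commB f -> commD f.
Proof. by move=> fB c [x [_ ->]]; apply: fB; exists x. Qed.

(** Moving [phi] across [c] turns [c] into its Goldman image. The two agree in the regular
    representation, hence also at [G]. *)
Lemma commD_phi : commD phi.
Proof.
move=> c [x [xR ->]].
rewrite (fev_intertwine (G := goldman G)); last exact: phiG.
have [y yE] := polynomial_goldman x.
congr (_ *m _); rewrite -[LHS]yE; apply: fev_regT_eq => //.
by rewrite yE xR.
Qed.

Lemma commDM f g : commD f -> commD g -> commD (f *m g).
Proof. by move=> fD gD c hc; rewrite -mulmxA gD // mulmxA fD // mulmxA. Qed.

Lemma commDL a f g : commD f -> commD g -> commD (a *: f + g).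
Proof.
by move=> fD gD c hc; rewrite mulmxDl mulmxDr -scalemxAl -scalemxAr fD // gD.
Qed.

(** [d] commutes with [tau c tau]; multiplying this relation by [tau] on both sides leaves a factor
    [c0] to cancel. *)
Lemma commD_conj_tau d : commD d -> commD (tau *m d *m tau).
Proof.
move=> dD c hc; have := dD _ (imC_conj_tau hc).
move=> /(congr1 (fun f => tau *m f *m tau)); rewrite !mulmxA tau2 -!mulmxA tau2.
rewrite !mul_mx_scalar !mul_scalar_mx -!scalemxAr.
by move/(scalerI c0_neq0); rewrite !mulmxA.
Qed.

Lemma commD_decomposition d : commD d ->
  exists f g, [/\ commB f, commB g & d = f + g *m phi].
Proof.
move=> dD; set t := tau *m d *m tau.
have tD : commD t := commD_conj_tau dD.
have dt : d *m tau = c0^-1 *: (tau *m t).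
  by rewrite /t !mulmxA tau2 mul_scalar_mx -!scalemxAl scalerA (mulVf c0_neq0) scale1r.
have td : tau *m d = c0^-1 *: (t *m tau).
  by rewrite /t -!mulmxA tau2 mul_mx_scalar -!scalemxAr scalerA (mulVf c0_neq0) scale1r.
have tt : t *m tau = c0 *: (tau *m d).
  by rewrite td scalerA (mulfV c0_neq0) scale1r.
have tt' : tau *m t = c0 *: (d *m tau).
  by rewrite dt scalerA (mulfV c0_neq0) scale1r.
have comb a : commD (2^-1 *: (a *: t + d)).
  by move=> c hc; rewrite -scalemxAl -scalemxAr commDL.
(* The half anticommuting with [tau] is written as [g *m phi] with [g] equal to [e] times that half
   times [phi], since [e * phi ^ 2 = e * e = 1]. *)
exists (2^-1 *: (c0^-1 *: t + d)), (e *: (2^-1 *: (- c0^-1 *: t + d) *m phi)).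
split.
- apply: commBP => //; rewrite -scalemxAl -scalemxAr mulmxDl mulmxDr.
  by rewrite -scalemxAl -scalemxAr -td -dt addrC.
- apply: commBP.
    have := commDL e (commDM (comb (- c0^-1)) commD_phi) (commB_commD _ (f := 0)).
    by rewrite addr0; apply=> a _; rewrite mul0mx mulmx0.
  (* Both factors of [f *m phi] anticommute with [tau], so their product commutes with it. *)
  rewrite -[LHS]scalemxAl -[RHS]scalemxAr; congr (_ *: _).
  set f := 2^-1 *: _; have ft : f *m tau = - (tau *m f).
    rewrite /f -scalemxAl -scalemxAr -scalerN; congr (_ *: _).
    rewrite mulmxDl mulmxDr opprD -scalemxAl -scalemxAr !scaleNr opprK -td -dt.
    by rewrite addrC.
  by rewrite -mulmxA phi_tau !mulmxN !mulmxA ft mulNmx opprK.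
rewrite -scalemxAl -mulmxA phi2 mul_mx_scalar scalerA e2 scale1r -scalerDr.
rewrite addrACA scaleNr subrr add0r -mulr2n -scaler_nat scalerA.
by rewrite (mulVf two_neq0) scale1r.
Qed.

(** Conjugation by [tau] sends [f + g phi] to [c0 (f - g phi)], so both combinations vanish; [phi]
    is invertible because [phi ^ 2 = e]. *)
Lemma commB_phi_free f g : commB f -> commB g -> f + g *m phi = 0 ->
  f = 0 /\ g = 0.
Proof.
move=> fB gB fg; have := congr1 (fun h => tau *m h *m tau) fg => /=.
rewrite mulmx0 mul0mx mulmxDr mulmxDl -(commB_tau fB) mulmxA -(commB_tau gB).
rewrite -!mulmxA phi_tau !mulmxN !(mulmxA tau tau) tau2 !mul_mx_scalar.
rewrite mul_scalar_mx -scalemxAr -scalerN -scalerDr => /eqP.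
rewrite scaler_eq0 (negPf c0_neq0) /= => /eqP fg'.
have f0 : f = 0.
  have /eqP : 2 *: f = 0.
    by rewrite scaler_nat -[RHS](addr0 0) -{1}fg -fg' addrACA subrr addr0 mulr2n.
  by rewrite scaler_eq0 (negPf two_neq0) /= => /eqP.
split=> //; move: fg; rewrite f0 add0r => /(congr1 (mulmx^~ phi)).
rewrite mul0mx -mulmxA phi2 mul_mx_scalar => /(congr1 ( *:%R e)).
by rewrite scaler0 scalerA e2 scale1r.
Qed.

Lemma commB_genP f : commB f <-> forall i, f *m G i = G i *m f.
Proof.
split=> [fB i|fG a [x ->]]; last exact: fev_intertwine.
by apply: fB; apply: imA_poly (polynomial_gen i).
Qed.

Lemma commB_vspace : exists U : {vspace 'M[K]_n}, forall f, f \in U <-> commB f.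
Proof.
exists (\bigcap_(i : 'I_r.-1) lker (linfun (mulmxr (G i) \- mulmx (G i))))%VS => f.
rewrite commB_genP memvE; split=> [/subv_bigcapP fU i|fG].
  by have := fU i isT; rewrite -memvE memv_ker lfunE /= => /eqP /subr0_eq.
apply/subv_bigcapP => i _; rewrite -memvE memv_ker lfunE /=.
by rewrite fG subrr.
Qed.

(** [W] is [U + U phi]. Both the directness of the sum and the injectivity of right multiplication
    by [phi] on [U] follow from [commB_phi_free]. *)
Lemma commD_vspace : exists U W : {vspace 'M[K]_n},
  [/\ forall f, f \in U <-> commB f, forall f, f \in W <-> commD f
    & \dim W = (2 * \dim U)%N].
Proof.
have [U UB] := commB_vspace.
pose g := linfun (mulmxr phi : 'M[K]_n -> 'M[K]_n).
have gE f : g f = f *m phi by rewrite lfunE.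
exists U, (U + g @: U)%VS; split=> // [f|].
  split=> [/memv_addP[a aU [b /memv_imgP[c cU ->] ->]]|].
    rewrite gE addrC -[c *m phi]scale1r.
    apply: commDL; last exact/commB_commD/UB.
    apply: commDM; last exact: commD_phi.
    exact/commB_commD/UB.
  move=> /commD_decomposition[a [b [aB bB ->]]].
  by rewrite -gE memv_add ?memv_img //; apply/UB.
rewrite dimv_disjoint_sum; last first.
  apply/eqP; rewrite -subv0; apply/subvP => f; rewrite memv_cap memv0.
  case/andP => fU /memv_imgP[b bU fE].
  have bU' : - b \in U by rewrite memvN.
  have [-> //] : f = 0 /\ - b = 0; last first.
  apply: commB_phi_free; [exact/UB|exact/UB|].
  by rewrite mulNmx fE gE subrr.
rewrite mul2n -addnn; congr (_ + _)%N; apply: limg_dim_eq.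
apply/eqP; rewrite -subv0; apply/subvP => f; rewrite memv_cap memv0 memv_ker gE.
case/andP => fU /eqP f0.
have [_ -> //] : (0 : 'M[K]_n) = 0 /\ f = 0.
apply: commB_phi_free.
- by apply/UB; rewrite mem0v.
- exact/UB.
by rewrite add0r.
Qed.

End DoubleCentralizer.

(** * Quadratic and braid relations as scalar identities in the coefficients *)

Section ScalarRelations.
Variables (F : comNzRingType) (N : nat) (d : F) (a b : 'I_N -> 'I_N -> F).
Hypothesis a_sym : forall k l, a k l = a l k.
Hypothesis a_sqr : forall k l, k != l -> a k l * a k l = 1.
Hypothesis a_diag : forall k, a k k * a k k = d * a k k + 1.
Hypothesis bE : forall k l, b k l = if (k < l)%N then d else 0.

Lemma quad_scalar (k l : 'I_N) (x y : F) : (k = l -> y = x) ->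
  a k l * (a l k * x + b l k * y) + b k l * (a k l * y + b k l * x) =
  d * (a k l * y + b k l * x) + x.
Proof.
have [-> -> //|nkl _] := eqVneq k l.
  by rewrite bE ltnn; have := a_diag l; move: (a l l) => c H; ring: H.
have := a_sqr nkl; rewrite (a_sym l k) !bE; move: (a k l) => c H.
by move: nkl; rewrite -val_eqE /=; case: ltngtP => //= _ _; ring: H.
Qed.

(** The variables [x...] are a coordinate of the six vectors obtained by permuting three letters;
    the hypotheses identify those that coincide when letters are equal. The cases follow the
    equalities and the order of the letters. *)
Lemma braid_scalar (k l n : 'I_N) (xkln xlkn xknl xlnk xnkl xnlk : F) :
  (k = l -> [/\ xlkn = xkln, xlnk = xknl & xnlk = xnkl]) ->
  (l = n -> [/\ xknl = xkln, xnkl = xlkn & xnlk = xlnk]) ->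
  (k = n -> [/\ xlnk = xlkn, xnkl = xknl & xnlk = xkln]) ->
  a k l * (a k n * (a l n * xnlk + b l n * xlnk) +
           b k n * (a l k * xkln + b l k * xlkn)) +
  b k l * (a l n * (a k n * xnkl + b k n * xknl) +
           b l n * (a k l * xlkn + b k l * xkln)) =
  a l n * (a k n * (a k l * xnlk + b k l * xnkl) +
           b k n * (a n l * xkln + b n l * xknl)) +
  b l n * (a k l * (a k n * xlnk + b k n * xlkn) +
           b k l * (a l n * xknl + b l n * xkln)).
Proof.
move=> ekl eln ekn; rewrite (a_sym l k) (a_sym n l).
have [e|nkl] := eqVneq k l.
  have [Elkn Elnk Enlk] := ekl e; subst l; have := a_diag k.
  have [e|nkn] := eqVneq k n.
    have [Elnk' Enkl _] := ekn e; subst n.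
    rewrite Enlk Enkl -Elnk Elnk' Elkn !bE ltnn.
    by move: (a k k) => u Hu; ring: Hu.
  rewrite Elkn Elnk Enlk; have := a_sqr nkn; move: (a k k) (a k n) => u v Hv Hu.
  rewrite !bE ltnn; move: nkn; rewrite -val_eqE /=.
  by case: ltngtP => //= _ _; ring: Hu Hv.
have [e|nln] := eqVneq l n.
  have [-> -> ->] := eln e; subst n; have := a_diag l; have := a_sqr nkl.
  move: (a l l) (a k l) => u v Hv Hu.
  rewrite !bE ltnn; move: nkl; rewrite -val_eqE /=.
  by case: ltngtP => //= _ _; ring: Hu Hv.
have := a_sqr nkl; have := a_sqr nln.
have [e|nkn] := eqVneq k n.
  have [-> -> ->] := ekn e; subst n; rewrite (a_sym l k); have := a_diag k.
  move: (a k k) (a k l) => u v Hu Hv _.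
  rewrite !bE ltnn; move: nkl; rewrite -val_eqE /=.
  by case: ltngtP => //= _ _; ring: Hu Hv.
move: (a k l) (a k n) (a l n) => u v w Hw Hu.
move: nkl nln nkn; rewrite !bE -!val_eqE /=.
by case: (ltngtP k l) => //=; case: (ltngtP l n) => //=; case: (ltngtP k n) => //=;
  try lia; move=> *; ring: Hu Hw.
Qed.

End ScalarRelations.

(** * Hecke relations for operators acting by weighted swaps *)

Section SwapModule.
Variables (F : comNzRingType) (m r n : nat) (d : F) (a b : 'I_(m + m) -> 'I_(m + m) -> F).
Hypothesis a_sym : forall k l, a k l = a l k.
Hypothesis a_sqr : forall k l, k != l -> a k l * a k l = 1.
Hypothesis a_diag : forall k, a k k * a k k = d * a k k + 1.
Hypothesis bE : forall k l, b k l = if (k < l)%N then d else 0.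
Variables (T : 'I_r.-1 -> 'M[F]_n) (X : Idx m r -> 'cV[F]_n).
Hypothesis TX : forall i u,
  T i *m X u = a (u (pos1 i)) (u (pos2 i)) *: X (swapIdx i u)
             + b (u (pos1 i)) (u (pos2 i)) *: X u.
Implicit Types (u w : Idx m r) (i j : 'I_r.-1).

Lemma swapIdxE i u p : swapIdx i u p = u (sgen i p).
Proof. by rewrite ffunE. Qed.

Lemma swapIdx_id i u : u (pos1 i) = u (pos2 i) -> swapIdx i u = u.
Proof.
by move=> e; apply/ffunP => p; rewrite swapIdxE /sgen; case: tpermP => [->|->|].
Qed.

Lemma swapIdxK i u : swapIdx i (swapIdx i u) = u.
Proof. by apply/ffunP => p; rewrite !swapIdxE -permM sgen_sgen perm1. Qed.

Let TXE := (mulmxDr, TX, =^~ scalemxAr).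

Lemma swap_quad i u : T i *m (T i *m X u) = d *: (T i *m X u) + X u.
Proof.
rewrite !TXE !swapIdxE sgen_pos1 sgen_pos2 swapIdxK.
apply/colP => p; rewrite !mxE.
apply: (quad_scalar a_sym a_sqr a_diag bE) => e.
by rewrite swapIdx_id.
Qed.

Lemma swap_comm i j u : (i.+1 < j)%N ->
  T i *m (T j *m X u) = T j *m (T i *m X u).
Proof.
move=> ij; rewrite !TXE !swapIdxE.
have fixp (p : 'I_r) : (p == j :> nat) || (p == j.+1 :> nat) -> sgen i p = p.
  by move=> h; apply: sgen_fix; lia.
have fixp' (p : 'I_r) : (p == i :> nat) || (p == i.+1 :> nat) -> sgen j p = p.
  by move=> h; apply: sgen_fix; lia.
rewrite ![sgen i _]fixp ?eqxx ?orbT // ![sgen j _]fixp' ?eqxx ?orbT //.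
have -> : swapIdx i (swapIdx j u) = swapIdx j (swapIdx i u).
  by apply/ffunP => p; rewrite !swapIdxE -!permM sgen_comm.
by apply/colP => p; rewrite !mxE; ring.
Qed.

Lemma swap_braid i j u : j = i.+1 :> nat ->
  T i *m (T j *m (T i *m X u)) = T j *m (T i *m (T j *m X u)).
Proof.
move=> ij; rewrite !TXE !swapIdxE.
have e21 : pos2 i = pos1 j by apply: val_inj.
have i2 : sgen i (pos2 j) = pos2 j by apply: sgen_fix => /=; lia.
have j1 : sgen j (pos1 i) = pos1 i by apply: sgen_fix => /=; lia.
have i1 : sgen i (pos1 j) = pos1 i by rewrite -e21 sgen_pos2.
have i1' : sgen i (pos1 i) = pos1 j by rewrite -e21 sgen_pos1.
rewrite !(e21, i1, i1', i2, j1, sgen_pos1, sgen_pos2) !swapIdxK.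
have sij : swapIdx j (swapIdx i (swapIdx j u)) = swapIdx i (swapIdx j (swapIdx i u)).
  by apply/ffunP => p; rewrite !swapIdxE -!permM (sgen_braid ij).
rewrite sij; apply/colP => p; rewrite !mxE.
apply: (braid_scalar a_sym a_sqr a_diag bE) => e.
- by rewrite (@swapIdx_id i u) // e21.
- by rewrite -sij (@swapIdx_id j u).
have siu : swapIdx j (swapIdx i u) = swapIdx i u.
  by rewrite swapIdx_id // !swapIdxE i1 i2.
have sju : swapIdx i (swapIdx j u) = swapIdx j u.
  by rewrite swapIdx_id // !swapIdxE j1 e21 sgen_pos1.
by rewrite siu sju swapIdxK.
Qed.

End SwapModule.

Lemma swap_hecke m r n (a b : 'I_(m + m) -> 'I_(m + m) -> K)
    (T : 'I_r.-1 -> 'M[K]_n) (X : Idx m r -> 'cV[K]_n) :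
  (forall k l, a k l = a l k) -> (forall k l, k != l -> a k l * a k l = 1) ->
  (forall k, a k k * a k k = qd * a k k + 1) ->
  (forall k l, b k l = if (k < l)%N then qd else 0) ->
  (forall i u, T i *m X u = a (u (pos1 i)) (u (pos2 i)) *: X (swapIdx i u)
                          + b (u (pos1 i)) (u (pos2 i)) *: X u) ->
  (forall A B : 'M[K]_n, (forall u, A *m X u = B *m X u) -> A = B) ->
  hecke_family T.
Proof.
move=> a_sym a_sqr a_diag bE TX X_inj.
split=> [i|i j ij|i j ij]; apply: X_inj => u.
- rewrite mulmxDl mul1mx -scalemxAl -mulmxA.
  exact: swap_quad a_sym a_sqr a_diag bE _ _ TX i u.
- by rewrite -!mulmxA; exact: (@swap_comm K m r n a b T X TX i j u ij).
by rewrite -!mulmxA; exact: (@swap_braid K m r n qd a b a_sym a_sqr a_diag bE T X TX i j u ij).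
Qed.

(** * The tensor space as a Hecke module *)

Section TensorSpace.
Variables (m r : nat).
Implicit Types (u w : Idx m r) (i j : 'I_r.-1).

Definition ev u : 'cV[K]_(dimT m r) := delta_mx (enum_rank u) 0.

Lemma ev_inj n (A B : 'M[K]_(n, dimT m r)) :
  (forall u, A *m ev u = B *m ev u) -> A = B.
Proof.
move=> AB; apply/trmx_inj/row_matrixP => j; rewrite -!tr_col; congr trmx.
by rewrite !colE -[j]enum_valK; apply: AB.
Qed.

Lemma mkEnd_ev (f : Idx m r -> Idx m r -> K) u c x b y :
  (forall w, f w u = (w == x)%:R * c + (w == y)%:R * b) ->
  mkEnd f *m ev u = c *: ev x + b *: ev y.
Proof.
move=> fE; apply/colP => i; rewrite -colE !mxE enum_rankK fE !eqxx !andbT.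
by rewrite -!(can2_eq (@enum_valK _) (@enum_rankK _)) mulrC [X in _ + X]mulrC.
Qed.

(** Coefficients of [T_i] on the swapped and on the original basis vector. For equal letters these
    vectors coincide, and [ca] carries the whole eigenvalue, [q] or [- q^-1]. *)
Definition ca (k l : 'I_(m + m)) : K :=
  if k == l then (sgn (par k) * qs + qd) / 2 else sgn (par k && par l).
Definition cb (k l : 'I_(m + m)) : K := if (k < l)%N then qd else 0.

Lemma piT_coef (F : fieldType) (x y s d t c : F) : (2 : F) != 0 -> t != 0 ->
  2^-1 * (t * (x * (2 * s / t) + y * (c * d / t)) + d * y) =
  s * x + (d * (1 + c) / 2) * y.
Proof. by move=> n2 nt; field; rewrite n2 nt. Qed.

Lemma piT_coef_diag (F : fieldType) (x s d t : F) : (2 : F) != 0 ->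
  2^-1 * (t * (s * x + 0 * x) + d * x) = ((s * t + d) / 2) * x + 0 * x.
Proof. by move=> n2; field; rewrite n2. Qed.

Lemma piT_ev i u : piT m i *m ev u =
  ca (u (pos1 i)) (u (pos2 i)) *: ev (swapIdx i u)
  + cb (u (pos1 i)) (u (pos2 i)) *: ev u.
Proof.
set k := u (pos1 i); set l := u (pos2 i); rewrite /piT /ca /cb.
rewrite -scalemxAl mulmxDl -scalemxAl mul_scalar_mx.
have [ekl|nkl] := eqVneq k l.
  rewrite /piTp (@mkEnd_ev _ _ (sgn (par k)) u 0 u); last first.
    by move=> w; rewrite -/k -/l ekl eqxx mulr0 addr0.
  rewrite swapIdx_id // ekl ltnn; apply/colP => p; rewrite !mxE.
  exact: piT_coef_diag two_neq0.
rewrite /piTp (@mkEnd_ev _ _ (2 * sgn (par k && par l) / qs) (swapIdx i u)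
  ((if (k < l)%N then 1 else -1) * qd / qs) u); last first.
  by move=> w; rewrite -/k -/l (negPf nkl).
apply/colP => p; rewrite !mxE.
rewrite ![_ / qs * _]mulrC (piT_coef _ _ _ _ _ two_neq0 qs_neq0).
congr (_ + _ * _); case: ltnP => _; last by rewrite subrr mulr0 mul0r.
by rewrite -(mulr_natr 1 2) mul1r mulfK // two_neq0.
Qed.

Lemma sgn_sqr x : sgn x * sgn x = 1.
Proof. by case: x; rewrite /sgn ?expr1 ?expr0 ?mulrNN mulr1. Qed.

Lemma ca_sym k l : ca k l = ca l k.
Proof. by rewrite /ca eq_sym andbC; case: eqVneq => // ->. Qed.

Lemma ca_sqr k l : k != l -> ca k l * ca k l = 1.
Proof. by rewrite /ca => /negPf->; rewrite sgn_sqr. Qed.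

Lemma diag_sqr (F : fieldType) (s t d : F) : (2 : F) != 0 -> s * s = 1 ->
  t ^+ 2 = d ^+ 2 + 4 ->
  (s * t + d) / 2 * ((s * t + d) / 2) = d * ((s * t + d) / 2) + 1.
Proof.
move=> n2 s1 t2; apply: (mulfI (four_neq0 n2)).
transitivity (s * s * t ^+ 2 + 2 * s * t * d + d ^+ 2); first by field; rewrite n2.
by rewrite s1 t2; field; rewrite n2.
Qed.

Lemma ca_diag k : ca k k * ca k k = qd * ca k k + 1.
Proof. by rewrite /ca eqxx; apply: diag_sqr two_neq0 (sgn_sqr _) qs_sqr. Qed.

Lemma cbE k l : cb k l = if (k < l)%N then qd else 0.
Proof. by []. Qed.

Lemma piT_hecke : hecke_family (@piT m r).
Proof. exact: swap_hecke ca_sym ca_sqr ca_diag cbE piT_ev (@ev_inj _). Qed.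

End TensorSpace.

(** * The operator [phi] and the Goldman involution *)

Section Phi.
Variables (m r : nat).
Implicit Types (u : Idx m r) (i : 'I_r.-1).

Definition revIdx u : Idx m r := [ffun p => rev_ord (u p)].
Definition phi_exp u : nat := \sum_(i < r) \sum_(j < r | (j < i)%N) par (u j).
Definition phi_sgn u : K := sgn (odd (phi_exp u)).

Lemma phi_sgnE u : phi_sgn u = (-1) ^+ phi_exp u.
Proof. exact: signr_odd. Qed.

Lemma phiT_ev u : phiT m r *m ev u = phi_sgn u *: ev (revIdx u).
Proof.
rewrite /phiT (@mkEnd_ev _ _ _ u (phi_sgn u) (revIdx u) 0 u).
  by rewrite scale0r addr0.
by move=> w; rewrite mulr0 addr0.
Qed.

Lemma par_rev (k : 'I_(m + m)) : par (rev_ord k) = ~~ par k.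
Proof. by rewrite /par /=; have := ltn_ord k; case: leqP; case: leqP => //; lia. Qed.

Lemma revIdxK u : revIdx (revIdx u) = u.
Proof. by apply/ffunP => p; rewrite !ffunE rev_ordK. Qed.

Lemma swap_revIdx i u : swapIdx i (revIdx u) = revIdx (swapIdx i u).
Proof. by apply/ffunP => p; rewrite !(swapIdxE, ffunE). Qed.

(** Reversal flips every parity, so each pair [j < i] contributes exactly one in total. *)
Lemma phi_exp_rev u : (phi_exp u + phi_exp (revIdx u) = (r * r.-1)./2)%N.
Proof.
rewrite /phi_exp -big_split /= -bin2 -bin2_sum big_mkord.
apply: eq_bigr => i _; rewrite -big_split /=.
rewrite (eq_bigr (fun=> 1%N)) => [|j _]; last by rewrite ffunE par_rev; case: par.
by rewrite (big_ord_narrow (ltnW (ltn_ord i))) sum1_card card_ord.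
Qed.

Lemma phi_expE u : phi_exp u = (\sum_(j < r) (r - j.+1) * par (u j))%N.
Proof.
rewrite /phi_exp (exchange_big_dep xpredT) //=; apply: eq_bigr => j _.
rewrite -(big_mkord (fun k => j < k)%N (fun=> par (u j) : nat)).
by rewrite -(big_nat_widenl j.+1 0 r xpredT) // sum_nat_const_nat.
Qed.

(** The weights [r - j.+1] of adjacent positions differ by one. The additive form avoids truncated
    subtraction. *)
Lemma phi_exp_swap i u :
  (phi_exp (swapIdx i u) + par (u (pos1 i)) = phi_exp u + par (u (pos2 i)))%N.
Proof.
have n12 : pos2 i != pos1 i by rewrite -val_eqE /= gtn_eqF.
have split2 v : phi_exp v =
    ((r - i.+1) * par (v (pos1 i)) + ((r - i.+2) * par (v (pos2 i)) +
     \sum_(j < r | (j != pos1 i) && (j != pos2 i)) (r - j.+1) * par (v j)))%N.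
  by rewrite phi_expE (bigD1 (pos1 i)) //= (bigD1 (pos2 i)).
rewrite !split2.
rewrite !swapIdxE sgen_pos1 sgen_pos2.
rewrite [X in (_ + (_ + X) + _ = _)%N](_ : _ =
    \sum_(j < r | (j != pos1 i) && (j != pos2 i)) (r - j.+1) * par (u j))%N; last first.
  apply: eq_bigr => j /andP[j1 j2]; rewrite swapIdxE; congr (_ * par (u _))%N.
  by apply: tpermD; rewrite eq_sym.
have -> : (r - i.+1 = (r - i.+2).+1)%N by have := pos2_proof i; lia.
by rewrite !mulSn; lia.
Qed.

Lemma phi_sgn_swap i u : phi_sgn (swapIdx i u) =
  phi_sgn u * (sgn (par (u (pos1 i))) * sgn (par (u (pos2 i)))).
Proof.
have /(congr1 (fun k => (-1) ^+ k * sgn (par (u (pos1 i))))) := phi_exp_swap i u.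
rewrite !exprD -!phi_sgnE -!/(sgn _) -!mulrA sgn_sqr mulr1 => ->.
by congr (_ * _); exact: mulrC.
Qed.

Lemma phiT_sqr : phiT m r *m phiT m r = (rsign r)%:M.
Proof.
apply: ev_inj => u; rewrite -mulmxA phiT_ev -scalemxAr phiT_ev scalerA revIdxK.
by rewrite mul_scalar_mx !phi_sgnE -exprD phi_exp_rev.
Qed.

Lemma rsign_sqr : rsign r * rsign r = 1.
Proof. by rewrite /rsign -expr2 sqrr_sign. Qed.

(** Modulo two, [(1 + x)(1 + y) = 1 + x + y + xy]. *)
Lemma sign_negb_and (F : comNzRingType) (x y : bool) :
  (-1) ^+ (~~ x && ~~ y) = - ((-1) ^+ (x && y) * ((-1) ^+ x * (-1) ^+ y)) :> F.
Proof. by case: x; case: y; rewrite /= !(expr0, expr1); ring. Qed.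

Lemma ca_rev (k l : 'I_(m + m)) : k != l ->
  ca (rev_ord k) (rev_ord l) = - (ca k l * (sgn (par k) * sgn (par l))).
Proof.
by rewrite /ca (inj_eq rev_ord_inj) => /negPf->; rewrite !par_rev; apply: sign_negb_and.
Qed.

Lemma sign_negb_shift (F : fieldType) (x : bool) (t d : F) : (2 : F) != 0 ->
  ((-1) ^+ (~~ x) * t + d) / 2 = d - ((-1) ^+ x * t + d) / 2.
Proof. by move=> n2; case: x; rewrite /= !(expr0, expr1); field; rewrite n2. Qed.

Lemma ca_rev_diag (k : 'I_(m + m)) : ca (rev_ord k) (rev_ord k) = qd - ca k k.
Proof. by rewrite /ca !eqxx par_rev; apply: sign_negb_shift two_neq0. Qed.

Lemma cb_rev (k l : 'I_(m + m)) : k != l -> cb (rev_ord k) (rev_ord l) = qd - cb k l.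
Proof.
rewrite /cb -val_eqE /= => nkl; have := ltn_ord k; have := ltn_ord l => hl hk.
rewrite (_ : (m + m - k.+1 < _)%N = ~~ (k < l)%N); last by apply/idP/idP; lia.
by case: ltnP; rewrite ?subrr ?subr0.
Qed.

(** On equal letters reversal exchanges the eigenvalues [q] and [- q^-1]. On distinct letters it
    reverses their order, turning [cb] into [qd - cb], and the sign from [phi_sgn_swap] makes the
    swap coefficients opposite. *)
Lemma phiT_piT i : phiT m r *m piT m i = goldman (@piT m r) i *m phiT m r.
Proof.
apply: ev_inj => u; rewrite -!mulmxA phiT_ev piT_ev -scalemxAr.
rewrite mulmxBl mul_scalar_mx piT_ev mulmxDr -!scalemxAr !phiT_ev swap_revIdx.
rewrite ![revIdx u (_ i)]ffunE phi_sgn_swap.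
set k := u (pos1 i); set l := u (pos2 i); have [ekl|nkl] := eqVneq k l.
  rewrite (swapIdx_id ekl) ekl ca_rev_diag sgn_sqr mulr1 /cb !ltnn.
  rewrite !scale0r !addr0 -scalerBl subKr !scalerA.
  by congr (_ *: _); exact: mulrC.
rewrite (ca_rev nkl) (cb_rev nkl) scaleNr opprD opprK addrCA -scalerBl subKr scalerDr.
rewrite !scalerA; congr (_ *: _ + _ *: _); last exact: mulrC.
by rewrite mulrCA.
Qed.

End Phi.

(** * Dimensions, the crossed product and the isomorphism *)

Lemma has_dim_vspace m r (S : End m r -> Prop) (U : {vspace End m r}) :
  (forall f, f \in U <-> S f) -> has_dim S (\dim U).
Proof.
move=> US; exists (vbasis U); split; first exact: basis_free (vbasisP U).
by move=> f; rewrite (span_basis (vbasisP U)); split=> /US.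
Qed.

(** Multiplicativity of [Theta] in components: [e (phi y phi) phi = phi y], because [phi ^ 2 = e]
    and [e * e = 1]. *)
Lemma crossed_mul (F : comNzRingType) n (phi : 'M[F]_n) (e : F)
    (x0 x1 y0 y1 : 'M[F]_n) : phi *m phi = e%:M -> e * e = 1 ->
  x0 *m y0 + e *: (x1 *m (e *: (phi *m y1 *m phi)))
    + (x1 *m (e *: (phi *m y0 *m phi)) + x0 *m y1) *m phi =
  (x0 + x1 *m phi) *m (y0 + y1 *m phi).
Proof.
move=> phi2 e2; rewrite -!scalemxAr scalerA e2 scale1r !mulmxDl !mulmxDr.
rewrite -scalemxAl -(mulmxA x1 _ phi) -(mulmxA _ phi phi) phi2 mul_mx_scalar.
rewrite -scalemxAr scalerA e2 scale1r !mulmxA -!addrA; congr (_ + _).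
by rewrite addrC [X in X + _]addrC -addrA.
Qed.

Theorem theorem5p6 (m r : nat) (hr : (2 <= r)%N) :
  (* Theta maps the crossed product (B_q)^{psi_1}_{alpha_1}[Z_2] into D_q ... *)
  (forall x : bool -> End m r, inCP x -> Dq (Theta x)) /\
  (* ... onto D_q ... *)
  (forall d : End m r, Dq d -> exists x : bool -> End m r, inCP x /\ Theta x = d) /\
  (* ... injectively ... *)
  (forall x y : bool -> End m r, inCP x -> inCP y -> Theta x = Theta y -> x = y) /\
  (* ... K-linearly ... *)
  (forall (c : K) (x y : bool -> End m r), inCP x -> inCP y ->
     Theta (fun s => c *: x s + y s) = c *: Theta x + Theta y) /\
  (* ... unitally ... *)
  Theta (@cp_one m r) = 1%:M /\
  (* ... and multiplicatively w.r.t. the crossed product multiplication *)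
  (forall x y : bool -> End m r, inCP x -> inCP y ->
     Theta (cp_mul x y) = Theta x *m Theta y) /\
  (* in particular dim_K D_q = 2 dim_K B_q *)
  (exists d : nat, has_dim (@Bq m r) d /\ has_dim (@Dq m r) (2 * d)).
Proof.
(* [r >= 2] provides a generator from which to form [tau]. *)
have i0 : 'I_r.-1 by case: r hr => [|[|k]] // _; exact: ord0.
have hG := @piT_hecke m r; have phiG := @phiT_piT m r.
have phi2 := @phiT_sqr m r; have e2 := @rsign_sqr r.
split; [|split; [|split; [|split; [|split; [|split]]]]].
- move=> x xB; rewrite /Theta addrC -[_ *m phiT m r]scale1r.
  apply: (commDL (G := @piT m r)); last exact: commB_commD (xB false).
  by apply: commDM; [exact: commB_commD (xB true)|exact: commD_phi phiG].
- move=> d /(commD_decomposition hG phiG phi2 e2 i0)[f [g [fB gB ->]]].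
  by exists (fun s => if s then g else f); split=> [[]|].
- move=> x y xB yB xy; apply: functional_extensionality => s.
  have [f0 g0] : x false - y false = 0 /\ x true - y true = 0.
    have BB s' : commB (@piT m r) (x s' - y s').
      by move=> a aA; rewrite mulmxBl mulmxBr (xB s' a aA) (yB s' a aA).
    apply: (commB_phi_free hG phiG phi2 e2 i0) (BB false) (BB true) _.
    by rewrite mulmxBl addrACA -opprD; apply/eqP; rewrite subr_eq0; apply/eqP.
  by case: s; apply/eqP; rewrite -subr_eq0; apply/eqP.
- by move=> c x y _ _; rewrite /Theta mulmxDl -scalemxAl scalerDr addrACA.
- by rewrite /Theta /= mul0mx addr0.
- move=> x y _ _; rewrite /Theta /cp_mul !big_bool /=.
  (* Two components with two values of [s] each give four inner sums, and each keeps a single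
     [t]. *)
  do 4 rewrite [\sum_(_ | _ == _) _]big_mkcond big_bool /=.
  rewrite !(addr0, add0r) /alpha1 /= !scale1r addrC.
  exact: (crossed_mul (x false) (x true) (y false) (y true) phi2 e2).
have [U [W [UB WD dimW]]] := commD_vspace hG phiG phi2 e2 i0.
exists (\dim U); split; first exact: has_dim_vspace UB.
by rewrite -dimW; apply: has_dim_vspace WD.
Qed.
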